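(* Let $F$ be a field of characteristic zero and let $\alpha \in F\setminus\{0\}$. The trace $T$-ideal $\mathrm{Id}^{tr}(D_2^{t_{\alpha,\alpha}})$ is generated, as a trace $T$-ideal, by the polynomials $$f_1=[x_1,x_2],$$ $$f_3=\alpha^2x_1x_2+\alpha^2x_2x_1+\mathrm{Tr}(x_1)\mathrm{Tr}(x_2)-\alpha\,\mathrm{Tr}(x_1)x_2-\alpha\,\mathrm{Tr}(x_2)x_1-\alpha\,\mathrm{Tr}(x_1x_2).$$ Moreover, $c_n^{tr}(D_2^{t_{\alpha,\alpha}})=2^n$ (for every $n\ge 1$).
   Context: $F$ is a field of characteristic 0. An algebra with trace is a unitary associative $F$-algebra $A$ with an $F$-linear map $\mathrm{tr}:A\to F$ such that $\mathrm{tr}(ab)=\mathrm{tr}(ba)$; a scalar $\alpha\in F$ is identified with $\alpha\cdot 1_A$. The free algebra with trace $F\langle X,\mathrm{Tr}\rangle\cong F\langle X\rangle\otimes F[\mathrm{Tr}(M)]$ on $X=\{x_1,x_2,\dots\}$ is generated by the free unitary associative algebra $F\langle X\rangle$ and central commuting indeterminates $\mathrm{Tr}(M)$, $M$ a nonempty word in $X$, subject to $\mathrm{Tr}(MN)=\mathrm{Tr}(NM)$ and $\mathrm{Tr}(\mathrm{Tr}(M)N)=\mathrm{Tr}(M)\mathrm{Tr}(N)$. An element $f$ is a trace identity of $A$ if it becomes $0$ whenever the variables $x_i$ are replaced by arbitrary elements of $A$ and $\mathrm{Tr}$ by $\mathrm{tr}$; $\mathrm{Id}^{tr}(A)$ is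 the set of trace identities of $A$. A trace $T$-ideal is an ideal of $F\langle X,\mathrm{Tr}\rangle$ invariant under all endomorphisms of the free algebra with trace, i.e. under all substitutions $x_i\mapsto g_i$ (performed also inside $\mathrm{Tr}$), where $g_i$ is a linear combination of products of a (possibly empty) product of traces with a nonempty word. The trace $T$-ideal generated by a set is the smallest one containing it. $MT_n$ is the space of multilinear elements of $F\langle X,\mathrm{Tr}\rangle$ in $x_1,\dots,x_n$, i.e. the span of all $\mathrm{Tr}(x_{i_1}\cdots x_{i_a})\cdots \mathrm{Tr}(x_{j_1}\cdots x_{j_b})x_{l_1}\cdots x_{l_c}$ in which each of $x_1,\dots,x_n$ occurs exactly once (possibly no traces, possibly no letters outside traces). $c_n^{tr}(A)=\dim_F MT_n/(MT_n\cap \mathrm{Id}^{tr}(A))$. $[a,b]=ab-ba$. $D_2$ is the algebra of $2\times2$ diagonal matrices over $F$, and $D_2^{t_{\alpha,\alpha}}$ is $D_2$ with the trace $t_{\alpha,\alpha}(\mathrm{diag}(a,b))=\alpha (a+b)$. *)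

(* Defs.v *)
From HB Require Import structures.
From mathcomp Require Import all_boot all_order all_algebra.
From mathcomp Require Import finmap.
From mathcomp.multinomials Require Import monalg.

Set Implicit Arguments.
Unset Strict Implicit.
Unset Printing Implicit Defensive.

Import GRing.Theory.
Local Open Scope quotient_scope.
Local Open Scope ring_scope.

(* The letters x_1, x_2, ... are represented by 0, 1, ... : nat.             *)
Definition nword := {w : seq nat | w != [::]}.

Definition rotation (u v : nword) : bool :=
  [exists k : 'I_(size (val u)).+1, rot k (val u) == val v].

Lemma rotationP (u v : nword) :
  reflect (exists k, rot k (val u) = val v) (rotation u v).
Proof.
apply: (iffP existsP) => [[k /eqP<-]|[k uv]]; first by exists k.
case: (leqP k (size (val u))) => [le_ku|lt_uk].
  by exists (Ordinal (le_ku : (k < (size (val u)).+1)%N)); apply/eqP.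
by exists ord0; rewrite rot0 -uv rot_oversize // ltnW.
Qed.

Lemma rotation_refl : reflexive rotation.
Proof. by move=> u; apply/rotationP; exists 0; rewrite rot0. Qed.

Lemma rotation_sym : symmetric rotation.
Proof.
suff rsym u v : rotation u v -> rotation v u.
  by move=> u v; apply/idP/idP; apply: rsym.
case/rotationP=> k uv; apply/rotationP.
by exists (size (rot k (val u)) - k)%N; rewrite -uv -[RHS](rotK k) /rotr.
Qed.

Lemma rotation_trans : transitive rotation.
Proof.
move=> v u w /rotationP[k uv] /rotationP[l vw]; apply/rotationP.
by exists (rot_add (val u) k l); rewrite -rot_rot_add uv vw.
Qed.

Canonical rotation_equiv :=
  EquivRel rotation rotation_refl rotation_sym rotation_trans.

(* Two words M, M' have Tr(M) = Tr(M') in the free algebra with trace iff    *)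
(* M' is a rotation of M, so the indeterminates Tr(M) are indexed by cyclic  *)
(* nonempty words.                                                           *)
Definition cyclic_word := {eq_quot rotation}.

HB.instance Definition _ := Choice.on cyclic_word.

(* The product of the traces Tr(c), taken with multiplicity [traces m c],    *)
(* followed by the word [word m] outside the traces.                         *)
Record tmonom : predArgType := TMonom {
  traces : {cmonom cyclic_word};
  word : {fmonom nat}
}.

Definition tmonom_pair (m : tmonom) := (traces m, word m).
Definition pair_tmonom p := TMonom p.1 p.2.

Lemma tmonom_pairK : cancel tmonom_pair pair_tmonom.
Proof. by case. Qed.

(* Opaque on purpose: with transparent equality and choice operators, failed *)
(* unifications in {malg F[tmonom]} take minutes.                            *)
Fact tmonom_hasDecEq : hasDecEq.axioms_ tmonom.
Proof.
apply: (@hasDecEq.Build tmonom (fun a b => tmonom_pair a == tmonom_pair b)).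
move=> a b; apply: (iffP eqP) => [|-> //].
exact: (can_inj tmonom_pairK).
Qed.

HB.instance Definition _ := tmonom_hasDecEq.

Fact tmonom_hasChoice : hasChoice.axioms_ tmonom.
Proof. exact: CanHasChoice tmonom_pairK. Qed.

HB.instance Definition _ := tmonom_hasChoice.

Definition tmone : tmonom := TMonom mone mone.
Definition tmmul (m1 m2 : tmonom) : tmonom :=
  TMonom (mmul (traces m1) (traces m2)) (mmul (word m1) (word m2)).

Lemma tmmulA : associative tmmul.
Proof. by move=> m1 m2 m3; rewrite /tmmul /= !mulmA. Qed.
Lemma tmmul1m : left_id tmone tmmul.
Proof. by case=> t w; rewrite /tmmul /= !mul1m. Qed.
Lemma tmmulm1 : right_id tmone tmmul.
Proof. by case=> t w; rewrite /tmmul /= !mulm1. Qed.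
Lemma tmmul_eq1 m1 m2 : tmmul m1 m2 = tmone -> m1 = tmone /\ m2 = tmone.
Proof.
by case: m1 m2 => [t1 w1] [t2 w2] [/unitm[-> ->] /unitm[-> ->]].
Qed.

HB.instance Definition _ := Choice_isMonomialDef.Build tmonom
  tmmulA tmmul1m tmmulm1 tmmul_eq1.

Section FreeTraceAlgebra.
Variable F : fieldType.

Definition free_trace_algebra := {malg F[tmonom]}.
HB.instance Definition _ := GRing.Lalgebra.on free_trace_algebra.

Lemma free_trace_algebra_scaleAr (c : F) (f g : free_trace_algebra) :
  c *: (f * g) = f * (c *: g).
Proof.
have cC (h : free_trace_algebra) : h * malgC c = malgC c * h.
  rewrite [LHS]malgM_def [RHS]malgM_def fgmulUg fgmulgU.
  by apply: eq_bigr => k _; rewrite mulm1 mul1m mulrC.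
by rewrite -[LHS]mul_malgC -[c *: g]mul_malgC !mulrA cC.
Qed.

HB.instance Definition _ :=
  GRing.Lalgebra_isAlgebra.Build F free_trace_algebra free_trace_algebra_scaleAr.

Definition tvar (i : nat) : free_trace_algebra := << TMonom mone (fmu i) >>.

(* Tr(t w) = t Tr(w) for a product of traces t and a nonempty word w.  The   *)
(* free algebra has no element Tr(1), so monomials with empty word are sent  *)
(* to the dummy value 0; substitutions below never reach this case.          *)
Definition trace_monomial (m : tmonom) : free_trace_algebra :=
  if insub (word m : seq nat) is Some w
  then << TMonom (mmul (traces m) (ucm (\pi_cyclic_word (w : nword)))) mone >>
  else 0.

Definition Trace (f : free_trace_algebra) : free_trace_algebra :=
  mmap (GRing.in_alg free_trace_algebra) trace_monomial f.

(* Evaluation at x_i := phi i and Tr := T, where the values of T are central *)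
(* elements of A; when T is a trace the chosen representative of a cyclic    *)
(* word is irrelevant.                                                       *)
Section Evaluation.
Variables (A : algType F) (T : A -> A) (phi : nat -> A).

Definition eval_word (w : seq nat) : A := \prod_(i <- w) phi i.

Definition eval_monomial (m : tmonom) : A :=
  (\prod_(c <- finsupp (traces m)) T (eval_word (val (repr c))) ^+ traces m c)
  * eval_word (word m).

Definition trace_eval (f : free_trace_algebra) : A :=
  mmap (GRing.in_alg A) eval_monomial f.

End Evaluation.

Record traceAlgebra := TraceAlgebra {
  trace_sort :> algType F;
  tr : {scalar trace_sort};
  trC : forall a b : trace_sort, tr (a * b) = tr (b * a)
}.

Definition trace_identity (A : traceAlgebra) (f : free_trace_algebra) : Prop :=
  forall phi : nat -> A, trace_eval (fun a => (tr A a)%:A) phi f = 0.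

Definition trace_substitution (g : nat -> free_trace_algebra) :
  free_trace_algebra -> free_trace_algebra := trace_eval Trace g.

(* The substitutions x_i := g_i for which Tr(g_i) makes sense: every monomial *)
(* of g_i has a nonempty word.                                               *)
Definition admissible (g : nat -> free_trace_algebra) : Prop :=
  forall (i : nat) (m : tmonom), m \in msupp (g i) -> word m != mone.

Record trace_Tideal (I : free_trace_algebra -> Prop) : Prop := TraceTideal {
  Tideal0 : I 0;
  TidealD : forall f g, I f -> I g -> I (f + g);
  TidealMl : forall f g, I g -> I (f * g);
  TidealMr : forall f g, I f -> I (f * g);
  Tideal_subst : forall g f, admissible g -> I f -> I (trace_substitution g f)
}.

Definition generated_Tideal (S : free_trace_algebra -> Prop)
    (f : free_trace_algebra) : Prop :=
  forall I, trace_Tideal I -> (forall g, S g -> I g) -> I f.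

(* Number of occurrences of the letter i in m, inside and outside traces.    *)
Definition letter_degree (i : nat) (m : tmonom) : nat :=
  (\sum_(c <- finsupp (traces m)) traces m c * count_mem i (val (repr c))
   + count_mem i (word m : seq nat))%N.

Definition multilinear_monomial (n : nat) (m : tmonom) : Prop :=
  forall i : nat, letter_degree i m = (i < n)%N.

Definition MT (n : nat) (f : free_trace_algebra) : Prop :=
  forall m, m \in msupp f -> multilinear_monomial n m.

End FreeTraceAlgebra.

(* dim_F (U / W) = d for a subspace W of a subspace U of V: there are d      *)
(* elements of U whose classes form a basis of U / W.                        *)
Definition quotient_dim (F : fieldType) (V : lmodType F) (U W : V -> Prop)
    (d : nat) : Prop :=
  exists2 b : 'I_d -> V, forall i, U (b i) &
    forall v, U v -> exists! c : 'rV[F]_d, W (v - \sum_i c 0 i *: b i).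

Lemma quotient_dim_uniq (F : fieldType) (V : lmodType F) (U W : V -> Prop)
    (d e : nat) :
  W 0 -> (forall (c : F) v w, W v -> W w -> W (c *: v + w)) ->
  quotient_dim U W d -> quotient_dim U W e -> d = e.
Proof.
move=> W0 Wlin.
have Wsum n (c : 'rV[F]_n) (v : 'I_n -> V) :
    (forall i, W (v i)) -> W (\sum_i c 0 i *: v i).
  move=> Wv; elim/big_rec: _ => [|i x _ Wx]; first exact: W0.
  exact: Wlin.
suff le_dim d1 d2 : quotient_dim U W d1 -> quotient_dim U W d2 -> (d1 <= d2)%N.
  by move=> Ud Ue; apply/eqP; rewrite eqn_leq !le_dim.
case=> b Ub bP [b' Ub' b'P].
have coord n (u : 'I_n -> V) m (v : 'I_m -> V) : (forall i, U (v i)) ->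
    (forall v, U v -> exists! c : 'rV[F]_n, W (v - \sum_i c 0 i *: u i)) ->
    exists M : 'M[F]_(m, n), forall i, W (v i - \sum_j M i j *: u j).
  move=> Uv uP.
  have /fin_all_exists[c cP] i :
      exists c : 'rV[F]_n, W (v i - \sum_j c 0 j *: u j).
    by have [c [cP _]] := uP _ (Uv i); exists c.
  exists (\matrix_i c i) => i.
  by under eq_bigr do rewrite mxE.
have [P PP] := coord _ _ _ _ Ub b'P; have [Q QP] := coord _ _ _ _ Ub' bP.
have PQ1 : P *m Q = 1%:M.
  apply/row_matrixP => i; have [c [_ c_uniq]] := bP _ (Ub i).
  rewrite -[LHS]c_uniq ?row1 -?[RHS]c_uniq //.
    rewrite (bigD1 i) //= mxE !eqxx scale1r big1 ?addr0 ?subrr //.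
    by move=> j ji; rewrite mxE eqxx (negPf ji) scale0r.
  have := Wlin 1 _ _ (PP i) (Wsum _ (row i P) _ QP).
  congr W; rewrite scale1r.
  under [X in _ + X]eq_bigr do rewrite scalerBr mxE.
  rewrite sumrB addrA addrNK; congr (_ - _).
  under eq_bigr do rewrite scaler_sumr.
  rewrite exchange_big; apply: eq_bigr => k _.
  rewrite !mxE scaler_suml; apply: eq_bigr => j _.
  by rewrite scalerA.
have := mxrankM_maxl P Q; rewrite PQ1 mxrank1 => /leq_trans; apply.
exact: rank_leq_col.
Qed.

(* trace_codim A n d is the assertion c_n^tr(A) = d.                         *)
Definition trace_codim (F : fieldType) (A : traceAlgebra F) (n d : nat) : Prop :=
  quotient_dim (@MT F n) (fun f => MT n f /\ trace_identity A f) d.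

Section DiagonalMatrices.
Variable F : fieldType.

Definition diagonal : {pred 'M[F]_2} := fun M => is_diag_mx M.

Lemma diagonal_subalg_closed : GRing.subalg_closed diagonal.
Proof.
split=> [|c A B /is_diag_mxP dA /is_diag_mxP dB|A B].
- exact: scalar_mx_is_diag.
- by apply/is_diag_mxP => i j ij; rewrite !mxE dA // dB // mulr0 addr0.
move=> /is_diag_mxP dA /is_diag_mxP dB; apply/is_diag_mxP => i j ij.
rewrite mxE big1 // => k _; case: (eqVneq i k) => [<-|ik].
  by rewrite dB // mulr0.
by rewrite dA // mul0r.
Qed.

HB.instance Definition _ := GRing.isSubalgClosed.Build F 'M[F]_2 diagonal
  (GRing.subalg_closed_semi diagonal_subalg_closed).

Record D2 : predArgType := MkD2 { D2val : 'M[F]_2; D2valP : D2val \in diagonal }.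

HB.instance Definition _ := [isSub for D2val].
HB.instance Definition _ := [Choice of D2 by <:].
HB.instance Definition _ := [SubChoice_isSubAlgebra of D2 by <:].

Variable alpha : F.

Definition t_alpha (M : D2) : F := alpha * (val M 0 0 + val M 1 1).

Lemma t_alpha_scalar : scalar t_alpha.
Proof.
move=> c A B; rewrite /t_alpha linearP /= !mxE.
by rewrite addrACA -mulrDr [LHS]mulrDr mulrCA.
Qed.

HB.instance Definition _ := GRing.isLinear.Build F D2 F *%R t_alpha t_alpha_scalar.

Lemma t_alphaC (A B : D2) : t_alpha (A * B) = t_alpha (B * A).
Proof.
congr (_ * (_ + _)); rewrite !rmorphM /= !mxE; apply: eq_bigr => k _;
  have /is_diag_mxP dA := D2valP A; have /is_diag_mxP dB := D2valP B.
  by case: (eqVneq 0 k) => [<-|k0]; [rewrite mulrC | rewrite (dA _ k) ?(dB _ k) ?mul0r].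
by case: (eqVneq 1 k) => [<-|k1]; [rewrite mulrC | rewrite (dA _ k) ?(dB _ k) ?mul0r].
Qed.

Definition D2_trace : traceAlgebra F := TraceAlgebra t_alphaC.

End DiagonalMatrices.

(* Main.v *)
Require Import Defs.
From HB Require Import structures.
From mathcomp Require Import all_boot all_order all_algebra.
From mathcomp Require Import finmap ring.
From mathcomp.multinomials Require Import monalg.

Set Implicit Arguments.
Unset Strict Implicit.
Unset Printing Implicit Defensive.

Import GRing.Theory.
Local Open Scope quotient_scope.
Local Open Scope ring_scope.

(** Write y(u) = Tr(u)/alpha - u.  On a diagonal matrix diag(a, b) with trace
    alpha (a + b) this is diag(b, a): y is the exchange of the two diagonal
    entries, an automorphism of a commutative algebra.  The two generators say
    exactly this.  Modulo the trace T-ideal J that they generate, f1 makes all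
    elements commute ([ideal_comm]), and f3 is, up to the factor alpha^2 and
    commutators, the relation y(u v) = y(u) y(v) ([conjugate_mul],
    [conjugateM]).

    Hence for a word w = i_1 ... i_k the indeterminate Tr(w) is congruent to
    alpha (x_{i_1} ... x_{i_k} + y_{i_1} ... y_{i_k}) with y_i = y(x_i)
    ([conjugate_word]), and every element is congruent to a polynomial in the
    commuting elements x_i, y_i ([reducible_any]).  Evaluating x_i at
    diag(a_i, b_i) and reading the first diagonal entry sends x_i to a_i and y_i
    to b_i ([split_poly_value]), so an identity yields a polynomial in the a_i,
    b_i that vanishes at all points, hence is zero, because distinct commutative
    monomials are distinct characters and therefore linearly independent
    ([monomial_values_free]).  This proves that J contains every identity; J
    consists of identities because the identities of an algebra with trace form
    a trace T-ideal ([trace_identity_Tideal]) and f1, f3 are identities.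

    The congruence respects the number of occurrences of each letter, x_i and
    y_i both counting for the letter i ([reducible_homogeneous]).  A multilinear
    element of degree n is therefore congruent to a combination of the 2^n
    products z_1 ... z_n with z_i in {x_i, y_i}; these are multilinear, and the
    independence of monomials shows that they form a basis modulo identities. *)

(** * Commutative monomials as multisets of letters *)

Definition letters (I : choiceType) (m : {cmonom I}) : seq I :=
  flatten [seq nseq (m i) i | i <- finsupp m].

Lemma count_letters (I : choiceType) (m : {cmonom I}) i :
  count_mem i (letters m) = m i.
Proof.
rewrite count_flatten -map_comp sumnE big_map.
under eq_bigr => j _ do rewrite /= count_nseq /=.
case: (finsuppP (cmonom_val m) i) => [im|im].
  rewrite big1_seq // => j /andP[_ jm].
  by case: (eqVneq j i) => // ji; rewrite -ji jm in im.
rewrite (bigD1_seq i) //= eqxx mul1n big1 ?addn0 // => j /negPf->.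
by rewrite mul0n.
Qed.

Lemma perm_letters (I : choiceType) (m : {cmonom I}) (s : seq I) :
  (forall i, count_mem i s = m i) -> perm_eq (letters m) s.
Proof. by move=> sm; apply/allP => i _; rewrite /= count_letters sm. Qed.

Lemma lettersM (I : choiceType) (m m' : {cmonom I}) :
  perm_eq (letters (mmul m m')) (letters m ++ letters m').
Proof. by apply: perm_letters => i; rewrite count_cat !count_letters cmM. Qed.

Lemma letters1 (I : choiceType) : letters (mone : {cmonom I}) = [::].
Proof. by rewrite /letters mdom1. Qed.

Lemma letters_ucm (I : choiceType) (i : I) : letters (ucm i) = [:: i].
Proof.
apply: perm_small_eq => //; apply: perm_letters => j.
by rewrite cmU /= addn0.
Qed.

Lemma prod_letters (R : pzSemiRingType) (I : choiceType) (z : I -> R)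
    (m : {cmonom I}) :
  \prod_(i <- letters m) z i = \prod_(i <- finsupp m) z i ^+ m i.
Proof.
rewrite big_flatten big_map; apply: eq_bigr => i _.
by rewrite big_nseq -Monoid.iteropE.
Qed.

Section WordsAsMultisets.
Variable I : choiceType.

Definition cmonom_of_seq (s : seq I) : {cmonom I} := \big[mmul/mone]_(i <- s) ucm i.

Lemma cmonom_of_seqE s i : cmonom_of_seq s i = count_mem i s.
Proof.
rewrite /cmonom_of_seq; elim: s => [|j s IHs]; first by rewrite big_nil cm1.
by rewrite big_cons cmM IHs cmU.
Qed.

Lemma letters_of_seq s : perm_eq (letters (cmonom_of_seq s)) s.
Proof. by apply: perm_letters => i; rewrite cmonom_of_seqE. Qed.

Lemma lettersK m : cmonom_of_seq (letters m) = m.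
Proof. by apply/eqP/cmP => i; rewrite cmonom_of_seqE count_letters. Qed.

Lemma sum_letters (m : {cmonom I}) (w : I -> nat) :
  (\sum_(i <- letters m) w i = \sum_(i <- finsupp m) m i * w i)%N.
Proof.
rewrite big_flatten big_map; apply: eq_bigr => i _.
by rewrite big_nseq iter_addn_0 mulnC.
Qed.

End WordsAsMultisets.

(** * Congruence modulo a two-sided ideal *)

Record ideal (R : pzRingType) (J : R -> Prop) : Prop := Ideal {
  ideal0 : J 0;
  idealD : forall u v, J u -> J v -> J (u + v);
  idealMl : forall u v, J v -> J (u * v);
  idealMr : forall u v, J u -> J (u * v)
}.

Section Ideal.
Variables (R : pzRingType) (J : R -> Prop) (J_ideal : ideal J).

Lemma idealN u : J u -> J (- u).
Proof. by rewrite -mulN1r; apply: (idealMl J_ideal). Qed.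

Lemma idealB u v : J u -> J v -> J (u - v).
Proof. by move=> Ju /idealN; apply: (idealD J_ideal). Qed.

Lemma congr_refl u : J (u - u).
Proof. by rewrite subrr; apply: (ideal0 J_ideal). Qed.

Lemma congr_sym u v : J (u - v) -> J (v - u).
Proof. by move=> /idealN; rewrite opprB. Qed.

Lemma congr_trans v u w : J (u - v) -> J (v - w) -> J (u - w).
Proof. by move=> Juv Jvw; rewrite -(subrKA v); apply: (idealD J_ideal). Qed.

Lemma congrD u u' v v' : J (u - u') -> J (v - v') -> J (u + v - (u' + v')).
Proof. by rewrite opprD addrACA; apply: (idealD J_ideal). Qed.

Lemma congrM u u' v v' : J (u - u') -> J (v - v') -> J (u * v - u' * v').
Proof.
move=> Ju Jv; have -> : u * v - u' * v' = (u - u') * v + u' * (v - v').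
  by rewrite mulrBl mulrBr addrA subrK.
by apply: (idealD J_ideal); [apply: (idealMr J_ideal)|apply: (idealMl J_ideal)].
Qed.

(** Products are compared modulo J and not in a quotient ring: for J a trace
    T-ideal, the factors commute only modulo J. *)
Lemma perm_prod_congr (I : eqType) (z : I -> R) (s t : seq I) :
  (forall i j, J (z i * z j - z j * z i)) -> perm_eq s t ->
  J (\prod_(i <- s) z i - \prod_(i <- t) z i).
Proof.
move=> zC; elim: s t => [|i s IHs] t.
  by rewrite perm_sym => /perm_nilP->; apply: congr_refl.
move=> st; have it : i \in t by rewrite -(perm_mem st) mem_head.
case/splitPr: it st => t1 t2 st.
rewrite big_cons; apply: (@congr_trans (z i * \prod_(j <- t1 ++ t2) z j)).
  apply: congrM; first exact: congr_refl.
  apply: IHs; rewrite -(perm_cons i); apply: (perm_trans st).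
  by rewrite -cat1s perm_catCA.
rewrite !big_cat big_cons /= !mulrA; apply: congrM; last exact: congr_refl.
elim: t1 {st IHs} => [|j t1 IHt]; first by rewrite big_nil mulr1 mul1r; apply: congr_refl.
rewrite big_cons mulrA; apply: (@congr_trans (z j * z i * \prod_(k <- t1) z k)).
  by apply: congrM; [apply: zC | apply: congr_refl].
rewrite -!mulrA; apply: congrM => //; exact: congr_refl.
Qed.

End Ideal.

Lemma idealZ (F : fieldType) (A : algType F) (J : A -> Prop) (c : F) u :
  ideal J -> J u -> J (c *: u).
Proof. by move=> JI Ju; rewrite -mulr_algl; apply: (idealMl JI). Qed.

Lemma congrP (F : fieldType) (A : algType F) (J : A -> Prop) (c : F) u u' v v' :
  ideal J -> J (u - u') -> J (v - v') -> J (c *: u + v - (c *: u' + v')).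
Proof. by move=> JI Ju Jv; apply: congrD => //; rewrite -scalerBr; apply: idealZ. Qed.

Lemma congr_eqr (R : pzRingType) (J : R -> Prop) u v v' :
  v = v' -> J (u - v') -> J (u - v).
Proof. by move=> ->. Qed.

(** Instance of the congruence lemmas in which congruence is equality. *)
Lemma zero_ideal (R : pzRingType) : ideal (eq (0 : R)).
Proof.
by split=> // u v; [move=> <- <-; rewrite addr0 | move=> <-; rewrite mulr0
  | move=> <-; rewrite mul0r].
Qed.

(** * Linear extension of a function on monomials *)

Section LinearExtension.
Variables (F : fieldType) (K : choiceType).
Implicit Types f g : {malg F[K]}.

Lemma malg_supp_ind (P : {malg F[K]} -> Prop) f :
  P 0 -> (forall c g h, P g -> P h -> P (c *: g + h)) ->
  (forall m, m \in msupp f -> P << m >>) -> P f.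
Proof.
move=> P0 PD Pf; rewrite [f]monalgE big_seq.
elim/big_rec: _ => // m g mf Pg.
have -> : << f@_m *g m >> = f@_m *: << m >> :> {malg F[K]}.
  by apply/malgP => k; rewrite mcoeffZ !mcoeffU mulrnAr mulr1.
by apply: PD => //; apply: Pf.
Qed.

Lemma malg_ind (P : {malg F[K]} -> Prop) :
  P 0 -> (forall c g h, P g -> P h -> P (c *: g + h)) ->
  (forall m, P << m >>) -> forall f, P f.
Proof. by move=> P0 PD PU f; apply: malg_supp_ind. Qed.

Variable A : algType F.

Lemma mmap_linear (h : K -> A) : linear (mmap (GRing.in_alg A) h).
Proof.
move=> c f g; rewrite raddfD /=; congr (_ + _).
rewrite (mmapEw (msuppZ_le _ _)) mmapE scaler_sumr.
by apply: eq_bigr => k _; rewrite mcoeffZ /= !mulr_algl scalerA.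
Qed.

Lemma mmapU1 (h : K -> A) m : mmap (GRing.in_alg A) h << m >> = h m.
Proof. by rewrite mmapU /= scale1r mul1r. Qed.

End LinearExtension.

Lemma malgU1M (F : fieldType) (K : monomType) (m m' : K) :
  << m >> * << m' >> = << mmul m m' >> :> {malg F[K]}.
Proof. by rewrite malgM_def fgmulUU mulr1. Qed.

Section LinearFunctions.
Variables (F : fieldType) (U V : lmodType F) (A : algType F).

Lemma linear_at0 (T : U -> V) : linear T -> T 0 = 0.
Proof. by move=> TL; have := TL (-1) 0 0; rewrite scaler0 addr0 scaleN1r addNr. Qed.

Lemma linear_scaleB (T : U -> V) c u v : linear T -> T (c *: u - v) = c *: T u - T v.
Proof.
move=> TL; rewrite addrC -scaleN1r TL scaleN1r addrC -[c *: u]addr0 TL.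
by rewrite linear_at0 // addr0.
Qed.

Lemma id_linear : linear (fun u : U => u).
Proof. by []. Qed.

Lemma comp_linear (T : U -> V) (W : lmodType F) (S : V -> W) :
  linear S -> linear T -> linear (fun u => S (T u)).
Proof. by move=> SL TL c u v; rewrite TL SL. Qed.

Lemma mull_linear (T : U -> A) (a : A) : linear T -> linear (fun u => a * T u).
Proof. by move=> TL c u v; rewrite TL mulrDr scalerAr. Qed.

Lemma mulr_linear (T : U -> A) (a : A) : linear T -> linear (fun u => T u * a).
Proof. by move=> TL c u v; rewrite TL mulrDl scalerAl. Qed.

End LinearFunctions.

Lemma malg_linear_eq_supp (F : fieldType) (K : choiceType) (V : lmodType F)
    (g h : {malg F[K]} -> V) f :
  linear g -> linear h -> (forall m, m \in msupp f -> g << m >> = h << m >>) ->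
  g f = h f.
Proof.
move=> gL hL ghU; apply: (@malg_supp_ind _ _ (fun u => g u = h u)) => //.
  by rewrite !linear_at0.
by move=> c u v gu gv; rewrite gL hL gu gv.
Qed.

Lemma malg_linear_eq (F : fieldType) (K : choiceType) (V : lmodType F)
    (g h : {malg F[K]} -> V) :
  linear g -> linear h -> (forall m, g << m >> = h << m >>) -> g =1 h.
Proof. by move=> gL hL gh f; apply: malg_linear_eq_supp. Qed.

Lemma sub_linear (F : fieldType) (U V : lmodType F) (S T : U -> V) :
  linear S -> linear T -> linear (fun u => S u - T u).
Proof. by move=> SL TL c u v; rewrite SL TL scalerBr opprD addrACA. Qed.

Lemma malg_linear_ideal (F : fieldType) (K : choiceType) (A : algType F)
    (J : A -> Prop) (g : {malg F[K]} -> A) :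
  ideal J -> linear g -> (forall m, J (g << m >>)) -> forall f, J (g f).
Proof.
move=> JI gL gJ; apply: (@malg_ind _ _ (fun f => J (g f))) => //.
  by rewrite linear_at0 //; apply: (ideal0 JI).
by move=> c u v Ju Jv; rewrite gL; apply: (idealD JI) => //; apply: idealZ.
Qed.

Lemma congr_lincomb (F : fieldType) (A : algType F) (V : lmodType F) (J : A -> Prop)
    (L : V -> A) (I : finType) (c : I -> F) (u : I -> A) (v : I -> V) :
  ideal J -> linear L -> (forall i, J (u i - L (v i))) ->
  J (\sum_i c i *: u i - L (\sum_i c i *: v i)).
Proof.
move=> JI LL uv; elim/big_rec2: _ => [|i y x _ Jxy].
  by rewrite linear_at0 //; apply: congr_refl.
by rewrite LL; apply: congrP.
Qed.

(** * Evaluation *)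

HB.instance Definition _ (F : fieldType) (A : algType F) (T : A -> A)
    (phi : nat -> A) :=
  GRing.isLinear.Build F (free_trace_algebra F) A *:%R (trace_eval T phi)
    (mmap_linear (eval_monomial T phi)).

HB.instance Definition _ (F : fieldType) :=
  GRing.isLinear.Build F (free_trace_algebra F) (free_trace_algebra F) *:%R
    (@Trace F) (mmap_linear (@trace_monomial F)).

Lemma trace_evalU (F : fieldType) (A : algType F) (T : A -> A) phi m :
  trace_eval T phi (<< m >> : free_trace_algebra F) = eval_monomial T phi m.
Proof. exact: mmapU1. Qed.

Lemma trace_evalP (F : fieldType) (A : algType F) (T : A -> A) phi c
    (f g : free_trace_algebra F) :
  trace_eval T phi (c *: f + g) = c *: trace_eval T phi f + trace_eval T phi g.
Proof. exact: linearP. Qed.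

Lemma TraceU (F : fieldType) m :
  Trace (<< m >> : free_trace_algebra F) = trace_monomial F m.
Proof. exact: mmapU1. Qed.

(** The properties shared by a trace a |-> tr(a).1 and by the formal trace of the
    free algebra, so that evaluation and substitution are treated together. *)
Record trace_map (F : fieldType) (A : algType F) (T : A -> A) : Prop := TraceMap {
  trace_map_linear : linear T;
  trace_map_central : forall a b, T a * b = b * T a;
  trace_mapC : forall a b, T (a * b) = T (b * a);
  trace_mapM : forall a b, T (T a * b) = T a * T b
}.

Lemma scalar_trace_map (F : fieldType) (A : traceAlgebra F) :
  trace_map (fun a : A => (tr A a)%:A).
Proof.
split=> [c a b|a b|a b|a b].
- by rewrite linearP /= scalerDl scalerA.
- by rewrite mulr_algl mulr_algr.
- by rewrite trC.
- by rewrite !mulr_algl linearZ /= scalerA.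
Qed.

Section EvalHom.
Variables (F : fieldType) (A : algType F) (T : A -> A) (phi : nat -> A).
Hypothesis T_trace : trace_map T.

Local Notation ev := (trace_eval T phi).
Local Notation ftrace := (fun c : cyclic_word => T (eval_word phi (val (repr c)))).

Lemma eval_monomialE m : eval_monomial T phi m =
  \prod_(c <- letters (traces m)) ftrace c * eval_word phi (word m).
Proof. by rewrite prod_letters. Qed.

Lemma prod_ftrace_central (s : seq cyclic_word) a :
  \prod_(c <- s) ftrace c * a = a * \prod_(c <- s) ftrace c.
Proof.
elim: s => [|c s IHs]; first by rewrite big_nil mulr1 mul1r.
by rewrite big_cons -mulrA IHs mulrA (trace_map_central T_trace) mulrA.
Qed.

Lemma perm_prod_ftrace (s t : seq cyclic_word) : perm_eq s t ->
  \prod_(c <- s) ftrace c = \prod_(c <- t) ftrace c.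
Proof.
move=> st; apply/subr0_eq/esym; move: st.
apply: (perm_prod_congr (zero_ideal A)) => c d.
by rewrite (trace_map_central T_trace) subrr.
Qed.

Lemma eval_monomialM m m' :
  eval_monomial T phi (mmul m m') = eval_monomial T phi m * eval_monomial T phi m'.
Proof.
rewrite !eval_monomialE /= (perm_prod_ftrace (lettersM _ _)) big_cat /=.
rewrite /eval_word fmM big_cat /= -!mulrA; congr (_ * _).
by rewrite !mulrA; congr (_ * _); rewrite prod_ftrace_central.
Qed.

(** Values of T are central, so the traces of the second monomial may be moved
    in front of the word of the first one. *)
Lemma trace_evalM f g : ev (f * g) = ev f * ev g.
Proof.
have evL : linear ev := trace_evalP T phi.
have fL u : linear (fun f : free_trace_algebra F => f * u) := mulr_linear u (@id_linear _ _).
have gL u : linear (fun f : free_trace_algebra F => u * f) := mull_linear u (@id_linear _ _).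
apply: (malg_linear_eq (comp_linear evL (fL g)) (mulr_linear _ evL)) => m.
apply: (malg_linear_eq (comp_linear evL (gL _)) (mull_linear _ evL)) => m'.
by rewrite malgU1M !trace_evalU eval_monomialM.
Qed.

Lemma trace_eval1 : ev 1 = 1.
Proof.
by rewrite trace_evalU eval_monomialE letters1 big_nil mul1r /eval_word fm1 big_nil.
Qed.

Lemma trace_eval_prod (I : Type) (s : seq I) (f : I -> free_trace_algebra F) :
  ev (\prod_(i <- s) f i) = \prod_(i <- s) ev (f i).
Proof. exact: (big_morph _ trace_evalM trace_eval1). Qed.

Lemma trace_eval_tvar i : ev (tvar F i) = phi i.
Proof.
rewrite trace_evalU eval_monomialE letters1 big_nil mul1r /eval_word.
by rewrite fmU big_seq1.
Qed.

End EvalHom.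

(** * The formal trace *)

Section FreeTrace.
Variable F : fieldType.
Implicit Types f g : free_trace_algebra F.

Lemma tmmulE m m' : mmul m m' =
  TMonom (mmul (traces m) (traces m')) (mmul (word m) (word m')).
Proof. by []. Qed.

Lemma trace_monomial_empty t : trace_monomial F (TMonom t mone) = 0.
Proof. by rewrite /trace_monomial fm1 insubF. Qed.

Lemma trace_monomial_nword t (s : {fmonom nat}) (w : nword) :
  s = val w :> seq nat ->
  trace_monomial F (TMonom t s) = << TMonom (mmul t (ucm (\pi_cyclic_word w))) mone >>.
Proof. by rewrite /trace_monomial /= => ->; rewrite valK. Qed.

Variant trace_monomial_spec t (s : {fmonom nat}) : free_trace_algebra F -> Type :=
| TraceMonomialEmpty of s = mone : trace_monomial_spec t s 0
| TraceMonomialNword (w : nword) of s = val w :> seq nat :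
    trace_monomial_spec t s << TMonom (mmul t (ucm (\pi_cyclic_word w))) mone >>.

Lemma trace_monomialP m : trace_monomial_spec (traces m) (word m) (trace_monomial F m).
Proof.
rewrite /trace_monomial; case: insubP => [w _ def_w|]; first by constructor.
rewrite negbK => /eqP wm; apply: TraceMonomialEmpty.
by apply/eqP; rewrite fmP wm fm1.
Qed.

Lemma TraceP c f g : Trace (c *: f + g) = c *: Trace f + Trace g.
Proof. exact: linearP. Qed.

(** The axioms are multilinear, hence checked on monomials.  If every word in
    sight is empty then both sides vanish, because the trace of a monomial with
    empty word is 0; otherwise symmetry is the invariance of cyclic words under
    rotation. *)
Lemma Trace_trace_map : trace_map (@Trace F).
Proof.
have TrL : linear (@Trace F) := TraceP.
have fL u : linear (fun f : free_trace_algebra F => f * u) := mulr_linear u (@id_linear _ _).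
have gL u : linear (fun f : free_trace_algebra F => u * f) := mull_linear u (@id_linear _ _).
split; first exact: TraceP.
- move=> f g.
  apply: (malg_linear_eq (mulr_linear g TrL) (mull_linear g TrL)) => m.
  apply: (malg_linear_eq (gL _) (fL _)) => m'.
  rewrite TraceU; case: trace_monomialP => [_|w _]; first by rewrite mul0r mulr0.
  by rewrite !malgU1M !tmmulE /= mul1m mulm1 [mmul (traces m') _]mulmC.
- move=> f g.
  apply: (malg_linear_eq (comp_linear TrL (fL g)) (comp_linear TrL (gL g))) => m.
  apply: (malg_linear_eq (comp_linear TrL (gL _)) (comp_linear TrL (fL _))) => m'.
  rewrite !malgU1M !TraceU.
  case: trace_monomialP => [/= mm1|u /= def_u].
    case/unitm: mm1 => m1 m'1; case: trace_monomialP => //= w.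
    by rewrite m1 m'1 mul1m fm1; case: w => [[]].
  case: trace_monomialP => [/= mm1|v /= def_v].
    case/unitm: mm1 => m'1 m1.
    by case: u def_u; rewrite m1 m'1 mul1m fm1 => -[].
  have -> : \pi_cyclic_word u = \pi_cyclic_word v.
    apply/eqmodP/rotationP; exists (size (word m)).
    by rewrite /= -def_u -def_v !fmM rot_size_cat.
  by rewrite [mmul (traces m) _]mulmC.
move=> f g.
apply: (malg_linear_eq (comp_linear TrL (mulr_linear g TrL))
  (mulr_linear (Trace g) TrL)) => m.
apply: (malg_linear_eq (comp_linear TrL (gL (Trace << m >>)))
  (mull_linear (Trace << m >>) TrL)) => m'.
rewrite TraceU; case: trace_monomialP => [_|w def_w].
  by rewrite !mul0r linear0.
rewrite malgU1M !TraceU.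
case: (trace_monomialP m') => [m'1|w' def_w'].
  by rewrite mulr0 tmmulE /= m'1 mul1m trace_monomial_empty.
rewrite (@trace_monomial_nword _ _ w') /= ?mul1m //.
by rewrite malgU1M !tmmulE /= mulm1 mulmA.
Qed.

(** The elements whose trace is meaningful: Tr(1) does not exist in the free
    algebra, whereas the value T(1) need not be 0, so evaluation commutes with the
    trace only on these elements. *)
Definition proper_words f := forall m, m \in msupp f -> word m != mone.

Lemma proper_wordsMl f g : proper_words f -> proper_words (f * g).
Proof.
move=> fP _ /msuppM_le[m1 [m2 [/fP m1P _ ->]]].
by apply: contra m1P; rewrite tmmulE /= => /eqP/unitm[-> _].
Qed.

Lemma proper_words_tvar i : proper_words (tvar F i).
Proof.
move=> m; rewrite msuppU1 inE => /eqP-> /=.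
by apply/eqP => /(congr1 (@fmonom_val nat)); rewrite fmU fm1.
Qed.

Lemma proper_words_eval_word (g : nat -> free_trace_algebra F) (w : nword) :
  admissible g -> proper_words (eval_word g (val w)).
Proof.
case: w => [[|i w] //= _] gP; rewrite /eval_word big_cons.
by apply: proper_wordsMl; apply: gP.
Qed.

Section EvalTrace.
Variables (A : algType F) (T : A -> A) (phi : nat -> A).
Hypothesis T_trace : trace_map T.

Lemma trace_map_rotation (u v : nword) : rotation u v ->
  T (eval_word phi (val u)) = T (eval_word phi (val v)).
Proof.
case/rotationP => k <-; rewrite -{1}(cat_take_drop k (val u)) /rot /eval_word.
by rewrite !big_cat (trace_mapC T_trace).
Qed.

Lemma trace_map_prod (s : seq cyclic_word) (G : cyclic_word -> A) a :
  T (\prod_(c <- s) T (G c) * a) = \prod_(c <- s) T (G c) * T a.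
Proof.
elim: s => [|c s IHs]; first by rewrite big_nil !mul1r.
by rewrite big_cons -mulrA (trace_mapM T_trace) IHs mulrA.
Qed.

(** The traces in a monomial leave T by [trace_mapM], and T does not see which rotation of
    the word represents its cyclic word. *)
Lemma trace_eval_Trace f : proper_words f ->
  trace_eval T phi (Trace f) = T (trace_eval T phi f).
Proof.
move=> fP; have evL := trace_evalP T phi.
apply: (malg_linear_eq_supp (comp_linear evL (@TraceP))
  (comp_linear (trace_map_linear T_trace) evL)).
move=> m /fP m1; rewrite TraceU trace_evalU.
case: trace_monomialP => [wm|w def_w]; first by rewrite wm eqxx in m1.
rewrite trace_evalU !eval_monomialE /= trace_map_prod.
rewrite (perm_prod_ftrace phi T_trace (lettersM _ _)) big_cat letters_ucm big_seq1 /=.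
have -> : eval_word phi (mone : {fmonom nat}) = 1 by rewrite /eval_word fm1 big_nil.
rewrite mulr1; congr (_ * _).
rewrite def_w; apply: trace_map_rotation.
by apply/eqmodP; rewrite reprK.
Qed.

Lemma trace_eval_subst (g : nat -> free_trace_algebra F) f : admissible g ->
  trace_eval T phi (trace_substitution g f) =
  trace_eval T (fun i => trace_eval T phi (g i)) f.
Proof.
move=> gP; move: f; apply: malg_linear_eq => [||m].
- exact: (comp_linear (trace_evalP T phi) (trace_evalP _ g)).
- exact: trace_evalP.
rewrite /trace_substitution !trace_evalU !eval_monomialE ?trace_evalM //;
  try exact: Trace_trace_map.
rewrite !trace_eval_prod //; congr (_ * _); apply: eq_bigr => c _.
rewrite trace_eval_Trace ?trace_eval_prod //.
exact: proper_words_eval_word.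
Qed.

End EvalTrace.

(** By [trace_eval_subst], evaluating after a substitution is an evaluation at
    another point. *)
Lemma trace_identity_Tideal (A : traceAlgebra F) : trace_Tideal (@trace_identity F A).
Proof.
have AT := scalar_trace_map A.
split=> [phi|f g fI gI phi|f g gI phi|f g fI phi|g f gP fI phi].
- by rewrite linear0.
- by rewrite linearD /= fI gI addr0.
- by rewrite trace_evalM // gI mulr0.
- by rewrite trace_evalM // fI mul0r.
by rewrite trace_eval_subst.
Qed.

Lemma generated_trace_Tideal S : trace_Tideal (@generated_Tideal F S).
Proof.
split=> [I II _|f g fI gI I II SI|f g gI I II SI|f g fI I II SI|g f gP fI I II SI].
- exact: (Tideal0 II).
- by apply: (TidealD II); [apply: fI|apply: gI].
- by apply: (TidealMl II); apply: gI.
- by apply: (TidealMr II); apply: fI.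
by apply: (Tideal_subst II) => //; apply: fI.
Qed.

End FreeTrace.

(** * The two generating identities *)

(** Up to the factor alpha^2 and commutators, this is the defect of
    multiplicativity of the conjugation u |-> Tr(u)/alpha - u; see
    [conjugate_mul]. *)
Definition conjugation_relation (F : fieldType) (A : algType F) (alpha : F)
    (u v tu tv tuv : A) : A :=
  alpha ^+ 2 *: (u * v) + alpha ^+ 2 *: (v * u) + tu * tv
  - alpha *: (tu * v) - alpha *: (tv * u) - alpha *: tuv.

Lemma conjugation_relation_morph (F : fieldType) (A B : algType F) (e : A -> B)
    (alpha : F) (x y tx ty txy : A) (x' y' tx' ty' txy' : B) :
  linear e -> {morph e : u v / u * v} ->
  e x = x' -> e y = y' -> e tx = tx' -> e ty = ty' -> e txy = txy' ->
  e (conjugation_relation alpha x y tx ty txy)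
  = conjugation_relation alpha x' y' tx' ty' txy'.
Proof.
move=> eL eM <- <- <- <- <-; rewrite /conjugation_relation.
have eB u v : e (u - v) = e u - e v.
  by rewrite -[u]scale1r linear_scaleB // !scale1r.
have eZ c u : e (c *: u) = c *: e u by rewrite -[c *: u]addr0 eL linear_at0 ?addr0.
have eD u v : e (u + v) = e u + e v by rewrite -[u]scale1r eL !scale1r.
by rewrite !(eB, eD, eZ, eM).
Qed.

Section GeneratorValues.
Variables (F : fieldType) (A : algType F) (T : A -> A) (phi : nat -> A).
Hypothesis T_trace : trace_map T.

Local Notation ev := (trace_eval T phi).

Lemma trace_evalB f g : ev (f - g) = ev f - ev g.
Proof. exact: linearB. Qed.

Lemma trace_eval_commutator i j :
  ev (tvar F i * tvar F j - tvar F j * tvar F i) = phi i * phi j - phi j * phi i.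
Proof. by rewrite trace_evalB !trace_evalM // !trace_eval_tvar. Qed.

Lemma trace_eval_Trace_tvar i : ev (Trace (tvar F i)) = T (phi i).
Proof. by rewrite trace_eval_Trace ?trace_eval_tvar //; apply: proper_words_tvar. Qed.

Lemma trace_eval_conjugation_relation (alpha : F) i j :
  ev (conjugation_relation alpha (tvar F i) (tvar F j)
        (Trace (tvar F i)) (Trace (tvar F j)) (Trace (tvar F i * tvar F j)))
  = conjugation_relation alpha (phi i) (phi j)
      (T (phi i)) (T (phi j)) (T (phi i * phi j)).
Proof.
have xx : proper_words (tvar F i * tvar F j).
  exact/proper_wordsMl/proper_words_tvar.
apply: (conjugation_relation_morph _ (trace_evalP T phi) (trace_evalM phi T_trace)).
- exact: trace_eval_tvar.
- exact: trace_eval_tvar.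
- exact: trace_eval_Trace_tvar.
- exact: trace_eval_Trace_tvar.
by rewrite (trace_eval_Trace phi T_trace xx) (trace_evalM phi T_trace) !trace_eval_tvar.
Qed.

End GeneratorValues.

(** * Monomials of the free algebra with trace *)

Section Monomials.
Variable F : fieldType.

Lemma eval_word_tvar (w : seq nat) :
  eval_word (tvar F) w = << TMonom mone (FMonom w) >>.
Proof.
elim: w => [|i w IHw].
  have -> : FMonom [::] = mone :> {fmonom nat} by rewrite -fmoneE.
  by rewrite /eval_word big_nil.
have -> : FMonom (i :: w) = mmul (fmu i) (FMonom w) by apply/eqP; rewrite fmP fmM fmU.
rewrite /eval_word big_cons -/(eval_word _ _) IHw malgU1M tmmulE.
by rewrite [mmul (traces _) _]mul1m.
Qed.

Lemma Trace_eval_word_tvar (w : nword) :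
  Trace (eval_word (tvar F) (val w)) = << TMonom (ucm (\pi_cyclic_word w)) mone >>.
Proof.
rewrite eval_word_tvar TraceU.
rewrite (trace_monomial_nword F mone (s := FMonom (val w)) (w := w)).
  by rewrite mul1m.
by [].
Qed.

(** Reading a monomial as the evaluation of itself at the letters writes it as a
    product of traces of words and of letters, to which multiplicative arguments
    apply. *)
Lemma eval_monomial_tvar m : eval_monomial (@Trace F) (tvar F) m = << m >>.
Proof.
rewrite eval_monomialE eval_word_tvar.
have -> : \prod_(c <- letters (traces m)) Trace (eval_word (tvar F) (val (repr c)))
    = << TMonom (cmonom_of_seq (letters (traces m))) mone >>.
  rewrite /cmonom_of_seq; elim: (letters _) => [|c s IHs]; first by rewrite !big_nil.
  by rewrite !big_cons IHs Trace_eval_word_tvar reprK malgU1M tmmulE /= mulm1.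
by rewrite lettersK malgU1M tmmulE /= mulm1 mul1m fmK; case: m.
Qed.

Lemma letter_degreeE i m : letter_degree i m =
  (\sum_(c <- letters (traces m)) count_mem i (val (repr c))
    + count_mem i (word m : seq nat))%N.
Proof. by rewrite sum_letters. Qed.

Lemma letter_degreeM i m m' :
  letter_degree i (mmul m m') = (letter_degree i m + letter_degree i m')%N.
Proof.
rewrite !letter_degreeE /= (perm_big _ (lettersM _ _)) big_cat /= fmM count_cat.
by rewrite addnACA.
Qed.

End Monomials.

(** * Reduction to commutative polynomials *)

Lemma conjugate_mul (F : fieldType) (A : algType F) (alpha : F) (u v tu tv tuv : A) :
  alpha != 0 -> tv * u = u * tv ->
  (alpha^-1 *: tu - u) * (alpha^-1 *: tv - v) - (alpha^-1 *: tuv - u * v) =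
  alpha ^- 2 *: conjugation_relation alpha u v tu tv tuv + (u * v - v * u).
Proof.
move=> a0 tvu; rewrite /conjugation_relation tvu !scalerBr !scalerDr !scalerA.
have -> : alpha ^- 2 * alpha ^+ 2 = 1 by rewrite mulVf // expf_neq0.
have -> : alpha ^- 2 * alpha = alpha^-1 by rewrite expr2 invfM mulfVK.
rewrite !scale1r mulrBl !mulrBr -!scalerAl -!scalerAr scalerA -invfM -expr2.
set p := u * v; set q := v * u; set r := _ *: (tu * tv); set s := _ *: (tu * v).
set t := _ *: (u * tv); set w := _ *: tuv.
by rewrite !opprB [RHS](AC (6*2) ((3*4)*(1*5)*(7*6)*(2*8))) /= subrr addr0.
Qed.

(** Polynomials in commuting variables indexed by pairs (i, b), standing for x_i
    when b is true and for y_i = Tr(x_i)/alpha - x_i when b is false. *)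
Notation spoly F := {malg F[{cmonom (nat * bool)%type}]}.

Section SplitPolynomials.
Variables (F : fieldType) (alpha : F).

Local Notation A := (free_trace_algebra F).

Definition conjugate (u : A) : A := alpha^-1 *: Trace u - u.

Definition split_letter (k : nat * bool) : A :=
  if k.2 then tvar F k.1 else conjugate (tvar F k.1).

Definition split_word (s : seq (nat * bool)) : A := \prod_(k <- s) split_letter k.

(** The factors of a commutative monomial are multiplied in the order of
    [letters]; any other order gives a congruent value ([perm_split_word]). *)
Definition split_poly (p : spoly F) : A :=
  mmap (GRing.in_alg A) (fun m => split_word (letters m)) p.

Lemma split_polyP c p q : split_poly (c *: p + q) = c *: split_poly p + split_poly q.
Proof. exact: mmap_linear. Qed.

Lemma split_polyU m : split_poly << m >> = split_word (letters m).
Proof. exact: mmapU1. Qed.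

Lemma split_word_cat s t : split_word (s ++ t) = split_word s * split_word t.
Proof. exact: big_cat. Qed.

End SplitPolynomials.

Definition split_degree (d : nat -> nat) (m : {cmonom (nat * bool)%type}) : Prop :=
  forall i, (m (i, true) + m (i, false))%N = d i.

Section Reduction.
Variables (F : fieldType) (alpha : F) (alpha_neq0 : alpha != 0).

Local Notation A := (free_trace_algebra F).
Variable J : A -> Prop.
Hypothesis JT : trace_Tideal J.

Lemma Tideal_ideal : ideal J.
Proof.
split; [exact: (Tideal0 JT)|exact: (TidealD JT)|exact: (TidealMl JT)|].
exact: (TidealMr JT).
Qed.
Local Notation JI := Tideal_ideal.

Hypothesis Jf1 : J (tvar F 0 * tvar F 1 - tvar F 1 * tvar F 0).

Let pair (u v : A) (i : nat) : A := if i == 0%N then u else v.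

Lemma pair_admissible u v : proper_words u -> proper_words v -> admissible (pair u v).
Proof. by move=> uP vP i m; rewrite /pair; case: ifP => _; [apply: uP|apply: vP]. Qed.

Lemma proper_comm u v : proper_words u -> proper_words v -> J (u * v - v * u).
Proof.
move=> uP vP; have := Tideal_subst JT (pair_admissible uP vP) Jf1.
by rewrite /trace_substitution (trace_eval_commutator _ (@Trace_trace_map F)).
Qed.

(** A monomial with empty word is a product of traces, hence central.  Two
    monomials with nonempty words form an admissible pair, which may be substituted
    in the commutator x_0 x_1 - x_1 x_0. *)
Lemma ideal_comm u v : J (u * v - v * u).
Proof.
have gL w : linear (fun f : A => f * w) := mulr_linear w (@id_linear _ _).
have fL w : linear (fun f : A => w * f) := mull_linear w (@id_linear _ _).
apply: (malg_linear_ideal JI (sub_linear (gL v) (fL v))) => m.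
apply: (malg_linear_ideal JI (sub_linear (fL _) (gL _))) => m'.
case: (eqVneq (word m) mone) => [m1|m1].
  rewrite !malgU1M !tmmulE m1 mul1m mulm1 [mmul (traces m') _]mulmC subrr.
  exact: (ideal0 JI).
case: (eqVneq (word m') mone) => [m'1|m'1].
  rewrite !malgU1M !tmmulE m'1 mul1m mulm1 [mmul (traces m') _]mulmC subrr.
  exact: (ideal0 JI).
apply: proper_comm => k.
  by rewrite msuppU1 inE => /eqP->.
by rewrite msuppU1 inE => /eqP->.
Qed.

Hypothesis Jf3 : J (conjugation_relation alpha (tvar F 0) (tvar F 1)
  (Trace (tvar F 0)) (Trace (tvar F 1)) (Trace (tvar F 0 * tvar F 1))).

Local Notation conjugate := (conjugate alpha).
Local Notation split_word := (split_word alpha).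
Local Notation split_poly := (split_poly alpha).

Lemma conjugateM u v : proper_words u -> proper_words v ->
  J (conjugate (u * v) - conjugate u * conjugate v).
Proof.
move=> uP vP; apply: (congr_sym JI).
have tvu := trace_map_central (@Trace_trace_map F) v u.
rewrite /conjugate (conjugate_mul v (Trace u) (Trace (u * v)) alpha_neq0 tvu).
apply: (idealD JI); last exact: ideal_comm.
apply: (idealZ _ JI); have := Tideal_subst JT (pair_admissible uP vP) Jf3.
by rewrite /trace_substitution (trace_eval_conjugation_relation _ (@Trace_trace_map F)).
Qed.

Lemma conjugate_word (w : nword) :
  J (conjugate (eval_word (tvar F) (val w)) - split_word [seq (i, false) | i <- val w]).
Proof.
case: w => [[|i w] //= _]; elim: w i => [|j w IHw] i.
  by rewrite /eval_word /split_word !big_seq1; apply: (congr_refl JI).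
have -> : eval_word (tvar F) [:: i, j & w] = tvar F i * eval_word (tvar F) (j :: w).
  by rewrite /eval_word big_cons.
have -> : split_word [seq (k, false) | k <- [:: i, j & w]] =
    conjugate (tvar F i) * split_word [seq (k, false) | k <- j :: w].
  by rewrite /split_word big_cons.
have wP : proper_words (eval_word (tvar F) (j :: w)).
  by rewrite /eval_word big_cons; apply/proper_wordsMl/proper_words_tvar.
have step := conjugateM (@proper_words_tvar F i) wP.
exact: (congr_trans JI step (congrM JI (congr_refl JI _) (IHw j))).
Qed.

Lemma perm_split_word s t : perm_eq s t -> J (split_word s - split_word t).
Proof. by apply: (perm_prod_congr JI) => i j; apply: ideal_comm. Qed.

Lemma split_polyM p q : J (split_poly (p * q) - split_poly p * split_poly q).
Proof.
have pL : linear split_poly := split_polyP alpha.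
have gL w : linear (fun f : spoly F => f * w) := mulr_linear w (@id_linear _ _).
have fL w : linear (fun f : spoly F => w * f) := mull_linear w (@id_linear _ _).
apply: (malg_linear_ideal JI (sub_linear (comp_linear pL (gL q))
  (mulr_linear (split_poly q) pL))) => m.
apply: (malg_linear_ideal JI (sub_linear (comp_linear pL (fL _))
  (mull_linear _ pL))) => m'.
have subst u v w u' v' w' : u = u' -> v = v' -> w = w' ->
  J (u' - v' * w') -> J (u - v * w) by move=> -> -> ->.
have mm' : split_poly (<< m >> * << m' >>) = split_word (letters (mmul m m')).
  by rewrite malgU1M split_polyU.
apply: (subst _ _ _ _ _ _ mm' (split_polyU alpha m) (split_polyU alpha m')).
rewrite -split_word_cat; apply: perm_split_word.
exact: lettersM.
Qed.

(** The existence of p suffices to describe the identities; the codimension needs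
    in addition the degrees of the monomials of p, which P prescribes. *)
Definition reducible (P : {cmonom (nat * bool)%type} -> Prop) (f : A) : Prop :=
  exists2 p : spoly F, forall m, m \in msupp p -> P m & J (f - split_poly p).

Lemma reducible_congr P f g : J (f - g) -> reducible P g -> reducible P f.
Proof. by move=> fg [p pP gp]; exists p => //; apply: (congr_trans JI fg gp). Qed.

Lemma reducible0 P : reducible P 0.
Proof.
exists 0; first by move=> m; rewrite msupp0.
rewrite (linear_at0 (split_polyP alpha)).
by rewrite subrr; apply: (ideal0 JI).
Qed.

Lemma reducibleP P c f g : reducible P f -> reducible P g -> reducible P (c *: f + g).
Proof.
case=> p pP fp [q qP gq]; exists (c *: p + q).
  move=> m /(fsubsetP (msuppD_le _ _)); rewrite in_fsetU => /orP[|/qP//].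
  by move/(fsubsetP (msuppZ_le _ _))/pP.
exact: (congr_eqr (split_polyP alpha c p q) (congrP c JI fp gq)).
Qed.

Lemma reducibleM d d' f g : reducible (split_degree d) f ->
  reducible (split_degree d') g ->
  reducible (split_degree (fun i => d i + d' i)%N) (f * g).
Proof.
case=> p pP fp [q qP gq]; exists (p * q).
  move=> _ /msuppM_le[m1 [m2 [/pP m1d /qP m2d ->]]] i.
  by rewrite !cmM -m1d -m2d addnACA.
apply: (congr_trans JI (congrM JI fp gq)).
by apply: (congr_sym JI); apply: split_polyM.
Qed.

Lemma reducible_split_word s :
  reducible (split_degree (fun i => count_mem (i, true) s + count_mem (i, false) s)%N)
    (split_word s).
Proof.
exists << cmonom_of_seq s >>.
  move=> m; rewrite msuppU1 => /fset1P->.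
  by move=> i; rewrite !cmonom_of_seqE.
apply: (congr_eqr (split_polyU alpha _)); apply: perm_split_word.
by rewrite perm_sym; apply: letters_of_seq.
Qed.

Lemma reducible_degree d d' f : d =1 d' ->
  reducible (split_degree d) f -> reducible (split_degree d') f.
Proof. by move=> dd' [p pP fp]; exists p => // m /pP md i; rewrite md dd'. Qed.

Lemma reducible_map_word b (w : seq nat) :
  reducible (split_degree (fun i => count_mem i w)) (split_word [seq (i, b) | i <- w]).
Proof.
apply: reducible_degree (reducible_split_word _) => i.
rewrite !count_map; case: b.
  rewrite [X in (_ + X)%N](eq_count (a2 := pred0)) => [|j]; last first.
    by rewrite /= xpair_eqE andbF.
  by rewrite count_pred0 addn0; apply: eq_count => j; rewrite /= xpair_eqE andbT.
rewrite [X in (X + _)%N](eq_count (a2 := pred0)) => [|j]; last first.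
  by rewrite /= xpair_eqE andbF.
by rewrite count_pred0 add0n; apply: eq_count => j; rewrite /= xpair_eqE andbT.
Qed.

Lemma reducible_word (w : seq nat) :
  reducible (split_degree (fun i => count_mem i w)) (eval_word (tvar F) w).
Proof.
by have := reducible_map_word true w; rewrite /split_word big_map.
Qed.

(** Tr(u) = alpha y(u) + alpha u, and y(u) is congruent to a product of the
    y_i. *)
Lemma reducible_trace (w : nword) :
  reducible (split_degree (fun i => count_mem i (val w)))
    (Trace (eval_word (tvar F) (val w))).
Proof.
set u := eval_word _ _.
have -> : Trace u = alpha *: conjugate u + alpha *: u.
  by rewrite -scalerDr subrK scalerA mulfV // scale1r.
apply: reducibleP.
  by apply: reducible_congr (conjugate_word w) _; apply: reducible_map_word.
by rewrite -[_ *: u]addr0; apply: reducibleP (reducible0 _); apply: reducible_word.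
Qed.

Lemma reducible_monomial m :
  reducible (split_degree (fun i => letter_degree i m)) << m >>.
Proof.
rewrite -eval_monomial_tvar eval_monomialE.
apply: reducible_degree (fun i => esym (letter_degreeE i m)) _.
apply: reducibleM; last exact: reducible_word.
elim: (letters _) => [|c s IHs].
  apply: (@reducible_degree (fun i => count_mem i [::])) => [i|].
    by rewrite big_nil.
  by have := reducible_word [::]; rewrite /eval_word !big_nil.
rewrite big_cons.
apply: (@reducible_degree (fun i => count_mem i (val (repr c)) +
  \sum_(j <- s) count_mem i (val (repr j)))%N) => [i|]; first by rewrite big_cons.
by apply: reducibleM => //; apply: reducible_trace.
Qed.

Lemma reducible_homogeneous d f :
  (forall m, m \in msupp f -> forall i, letter_degree i m = d i) ->
  reducible (split_degree d) f.
Proof.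
move=> fd; apply: malg_supp_ind; first exact: reducible0.
  by move=> c g h; apply: reducibleP.
by move=> m /fd md; apply: reducible_degree md (reducible_monomial m).
Qed.

Lemma reducible_any f : reducible (fun=> True) f.
Proof.
move: f; apply: malg_ind; first exact: reducible0.
  by move=> c g h; apply: reducibleP.
by move=> m; have [p _ mp] := reducible_monomial m; exists p.
Qed.

End Reduction.

(** * Linear independence of commutative monomials *)

Section Independence.
Variables (F : fieldType) (charF0 : [pchar F] =i pred0) (K : choiceType).

Definition monomial_value (phi : K -> F) (m : {cmonom K}) : F :=
  \prod_(k <- letters m) phi k.

Definition polynomial_value (phi : K -> F) (p : {malg F[{cmonom K}]}) : F :=
  \sum_(m <- msupp p) p@_m * monomial_value phi m.

Lemma monomial_valueM phi psi m :
  monomial_value (fun k => phi k * psi k) m = monomial_value phi m * monomial_value psi m.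
Proof. exact: big_split. Qed.

Lemma monomial_value1 m : monomial_value (fun=> 1) m = 1.
Proof. exact: big1_eq. Qed.

(** The point with value 2 at k and 1 elsewhere reads off the exponent of k,
    because the powers of 2 are distinct in characteristic 0. *)
Lemma monomial_value_separates m m' :
  (forall phi, monomial_value phi m = monomial_value phi m') -> m = m'.
Proof.
move=> mm'; apply/eqP/cmP => k.
have two_pow n : (2 : F) ^+ n = (2 ^ n)%:R by rewrite natrX.
have value2 n : monomial_value (fun j => if j == k then 2 else 1) n = (2 ^ n k)%:R.
  rewrite /monomial_value -big_mkcond big_const_seq count_letters.
  by rewrite -two_pow -Monoid.iteropE.
have := mm' (fun j => if j == k then 2 else 1); rewrite !value2.
have natr_inj a b : (a <= b)%N -> a%:R = b%:R :> F -> a = b.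
  move=> ab /eqP; rewrite eq_sym -subr_eq0 -natrB // ((pcharf0P F).1 charF0) subn_eq0.
  by move=> ba; apply/eqP; rewrite eqn_leq ab.
move=> E; apply/eqP; rewrite -(eqn_exp2l (m := 2)) //; apply/eqP.
by case: (leqP (2 ^ m k) (2 ^ m' k)) => [/natr_inj|/ltnW/natr_inj ->//]; apply.
Qed.

(** Independence of characters, after Dedekind: subtracting from the relation at
    psi * phi the value of m0 at psi times the relation at phi removes m0, and the
    shorter relation kills c m as soon as psi separates m from m0. *)
Lemma monomial_values_free (s : seq {cmonom K}) (c : {cmonom K} -> F) :
  uniq s -> (forall phi, \sum_(m <- s) c m * monomial_value phi m = 0) ->
  forall m, m \in s -> c m = 0.
Proof.
elim: s c => //= m0 s IHs c /andP[m0s s_uniq] c0.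
have cs m : m \in s -> c m = 0.
  move=> ms; apply/eqP/negPn/negP => cm.
  case/negP: m0s; suff -> : m0 = m by [].
  apply: monomial_value_separates => psi; apply/esym/eqP; rewrite -subr_eq0.
  suff /eqP : c m * (monomial_value psi m - monomial_value psi m0) = 0.
    by rewrite mulf_eq0 (negPf cm).
  apply: (IHs (fun n => c n * (monomial_value psi n - monomial_value psi m0))) ms => //.
  move=> phi; have := c0 (fun k => psi k * phi k).
  have := c0 phi; rewrite !big_cons => c0phi.
  rewrite monomial_valueM mulrA [c m0 * _]mulrC -mulrA (canRL (addrK _) c0phi) sub0r.
  rewrite mulrN => /eqP; rewrite addrC subr_eq0 => /eqP def_s.
  apply: (etrans (y := \sum_(n <- s) c n * monomial_value (fun k => psi k * phi k) n
     - monomial_value psi m0 * \sum_(n <- s) c n * monomial_value phi n)).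
    rewrite mulr_sumr -sumrB; apply: eq_bigr => n _; rewrite monomial_valueM.
    by rewrite mulrBr mulrBl -!mulrA; congr (_ - _); rewrite mulrCA.
  by rewrite def_s subrr.
move=> m; rewrite inE => /predU1P[->|/cs//].
have := c0 (fun=> 1); rewrite big_cons monomial_value1 mulr1 big1_seq ?addr0 //.
by move=> n /andP[_ /cs->]; rewrite mul0r.
Qed.

Lemma polynomial_value_inj p : (forall phi, polynomial_value phi p = 0) -> p = 0.
Proof.
move=> p0; apply/malgP => m; rewrite mcoeff0.
case: (boolP (m \in msupp p)) => [mp|/mcoeff_outdom //].
exact: (monomial_values_free (fset_uniq _) p0).
Qed.

End Independence.

(** * Evaluation at diagonal matrices *)

Section Points.
Variables (F : fieldType) (alpha : F) (alpha_neq0 : alpha != 0).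

Local Notation T := (fun a : D2_trace alpha => (tr (D2_trace alpha) a)%:A : D2_trace alpha).

Implicit Types M N : D2 F.

Definition entry (j : 'I_2) (M : D2 F) : F := val M j j.

Lemma entry_linear j c M N : entry j (c *: M + N) = c * entry j M + entry j N.
Proof. by rewrite /entry linearP !mxE. Qed.

Lemma entryZ j c M : entry j (c *: M) = c * entry j M.
Proof. by rewrite /entry linearZ !mxE. Qed.

Lemma entryM j M N : entry j (M * N) = entry j M * entry j N.
Proof.
rewrite /entry rmorphM /= mxE (bigD1 j) //= big1 ?addr0 // => k kj.
by have /is_diag_mxP -> := D2valP M; rewrite ?mul0r // eq_sym.
Qed.

Lemma entry1 j : entry j 1 = 1.
Proof. by rewrite /entry rmorph1 mxE eqxx. Qed.

Lemma entryP M N : (forall j, entry j M = entry j N) -> M = N.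
Proof.
move=> MN; apply: val_inj; apply/matrixP => i j.
have /is_diag_mxP dM := D2valP M; have /is_diag_mxP dN := D2valP N.
by case: (eqVneq i j) => [->|ij]; [apply: MN | rewrite /= dM ?dN].
Qed.

Lemma entry_tr j (M : D2_trace alpha) : entry j (T M) = alpha * (entry 0 M + entry 1 M).
Proof. by rewrite entryZ entry1 mulr1. Qed.

Fact diagonal_point (u : 'rV[F]_2) : diag_mx u \in @diagonal F.
Proof. exact: diag_mx_is_diag. Qed.

Definition point (phi : nat * bool -> F) (i : nat) : D2_trace alpha :=
  MkD2 (diagonal_point (\row_j phi (i, j == 0))).

Lemma entry_point phi i j : entry j (point phi i) = phi (i, j == 0).
Proof. by rewrite /entry !mxE eqxx. Qed.

(** The regular algebra of F is the target so that [entry] is a linear map between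
    algebras. *)
Lemma entry_linear_regular j : linear (entry j : D2_trace alpha -> F^o).
Proof. exact: entry_linear. Qed.

Lemma D2_commutator : trace_identity (D2_trace alpha) (tvar F 0 * tvar F 1 - tvar F 1 * tvar F 0).
Proof.
move=> phi; rewrite (trace_eval_commutator _ (scalar_trace_map (D2_trace alpha))).
apply/eqP; rewrite subr_eq0; apply/eqP/entryP => j.
by rewrite !entryM mulrC.
Qed.

Lemma D2_conjugation_relation : trace_identity (D2_trace alpha)
  (conjugation_relation alpha (tvar F 0) (tvar F 1)
    (Trace (tvar F 0)) (Trace (tvar F 1)) (Trace (tvar F 0 * tvar F 1))).
Proof.
move=> phi; rewrite (trace_eval_conjugation_relation _ (scalar_trace_map (D2_trace alpha))).
apply: entryP => j.
have eM : {morph (entry j : D2_trace alpha -> F^o) : M N / M * N} := entryM j.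
rewrite (conjugation_relation_morph alpha (entry_linear_regular j) eM erefl erefl
  (entry_tr j _) (entry_tr j _) (entry_tr j _)).
have -> : entry j (0 : D2_trace alpha) = 0 by rewrite -(scale0r 1) entryZ mul0r.
rewrite /conjugation_relation !entryM /GRing.scale /=.
have [->|->] : j = 0 \/ j = 1.
  by case: j {eM} => [[|[|//]] ?]; [left|right]; apply: val_inj.
all: ring.
Qed.

(** The first entry of y_i at diag(a, b) is alpha^-1 alpha (a + b) - a = b. *)
Lemma split_letter_value phi k :
  entry 0 (trace_eval T (point phi) (split_letter alpha k)) = phi k.
Proof.
have T_trace := scalar_trace_map (D2_trace alpha).
have eL := comp_linear (entry_linear_regular 0) (trace_evalP T (point phi)).
case: k => i [] /=; first by rewrite /split_letter /= trace_eval_tvar entry_point.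
apply: (etrans (linear_scaleB _ _ _ eL)); rewrite /GRing.scale /=.
rewrite (trace_eval_Trace_tvar _ T_trace) trace_eval_tvar entry_tr !entry_point.
by rewrite mulKf // addrAC subrr add0r.
Qed.

Lemma split_word_value phi s :
  entry 0 (trace_eval T (point phi) (split_word alpha s)) = \prod_(k <- s) phi k.
Proof.
rewrite /split_word (trace_eval_prod _ (scalar_trace_map (D2_trace alpha))).
elim: s => [|k s IHs]; first by rewrite !big_nil entry1.
by rewrite !big_cons entryM IHs split_letter_value.
Qed.

Lemma polynomial_value_linear (K : choiceType) (phi : K -> F) :
  linear (polynomial_value phi : {malg F[{cmonom K}]} -> F^o).
Proof.
have E p : polynomial_value phi p = mmap (GRing.in_alg F^o) (monomial_value phi) p.
  rewrite mmapE; apply: eq_bigr => m _.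
  by rewrite /= /GRing.scale /= mulr1.
by move=> c p q; rewrite !E (mmap_linear (A := F^o)).
Qed.

Lemma split_poly_value phi p :
  entry 0 (trace_eval T (point phi) (split_poly alpha p)) = polynomial_value phi p.
Proof.
have eL := comp_linear (entry_linear_regular 0) (trace_evalP T (point phi)).
move: p; apply: (malg_linear_eq (comp_linear eL (split_polyP alpha))
  (polynomial_value_linear phi)) => m.
rewrite (split_polyU alpha m) split_word_value.
by rewrite /polynomial_value msuppU1 big_seq_fset1 mcoeffUU mul1r.
Qed.

Lemma split_poly_identity (charF0 : [pchar F] =i pred0) p :
  trace_identity (D2_trace alpha) (split_poly alpha p) -> p = 0.
Proof.
move=> p0; apply: (polynomial_value_inj charF0) => phi.
by rewrite -split_poly_value p0 -(scale0r 1) entryZ mul0r.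
Qed.

End Points.

(** * Letter degrees *)

Section Homogeneous.
Variable F : fieldType.
Implicit Types f g : free_trace_algebra F.

Definition homogeneous (d : nat -> nat) f : Prop :=
  forall m, m \in msupp f -> forall i, letter_degree i m = d i.

Lemma homogeneousP d c f g : homogeneous d f -> homogeneous d g -> homogeneous d (c *: f + g).
Proof.
move=> fd gd m /(fsubsetP (msuppD_le _ _)); rewrite in_fsetU => /orP[|/gd//].
by move/(fsubsetP (msuppZ_le _ _))/fd.
Qed.

Lemma homogeneous0 d : homogeneous d 0.
Proof. by move=> m; rewrite msupp0. Qed.

Lemma homogeneous_lincomb d (I : finType) (c : I -> F) (b : I -> free_trace_algebra F) :
  (forall i, homogeneous d (b i)) -> homogeneous d (\sum_i c i *: b i).
Proof.
move=> bd; elim/big_rec: _ => [|i f _ fd]; first exact: homogeneous0.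
exact: homogeneousP.
Qed.

Lemma homogeneousM d d' f g : homogeneous d f -> homogeneous d' g ->
  homogeneous (fun i => d i + d' i)%N (f * g).
Proof.
move=> fd gd _ /msuppM_le[m1 [m2 [/fd m1d /gd m2d ->]]] i.
by rewrite letter_degreeM m1d m2d.
Qed.

Lemma homogeneous_eq d d' f : d =1 d' -> homogeneous d f -> homogeneous d' f.
Proof. by move=> dd' fd m /fd md i; rewrite md dd'. Qed.

Lemma homogeneousU m : homogeneous (fun i => letter_degree i m) << m >>.
Proof. by move=> k; rewrite msuppU1 => /fset1P->. Qed.

Lemma homogeneous1 : homogeneous (fun=> 0%N) 1.
Proof.
have -> : 1 = << mone >> :> free_trace_algebra F by [].
apply: (homogeneous_eq _ (@homogeneousU mone)) => i.
by rewrite letter_degreeE /= letters1 big_nil fm1.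
Qed.

Lemma homogeneous_tvar i : homogeneous (fun j => (i == j) : nat) (tvar F i).
Proof.
apply: (homogeneous_eq _ (@homogeneousU _)) => j.
by rewrite letter_degreeE /= letters1 big_nil fmU /= addn0.
Qed.

Lemma homogeneous_Trace_tvar i : homogeneous (fun j => (i == j) : nat) (Trace (tvar F i)).
Proof.
pose w : nword := exist (fun w : seq nat => w != [::]) [:: i] isT.
have -> : Trace (tvar F i) = << TMonom (ucm (\pi_cyclic_word w)) mone >>.
  by rewrite -Trace_eval_word_tvar /eval_word big_seq1.
apply: (homogeneous_eq _ (@homogeneousU _)) => j.
rewrite letter_degreeE /= letters_ucm big_seq1 fm1 addn0.
have /rotationP[k <-] : rotation w (repr (\pi_cyclic_word w)).
  by apply/eqmodP; rewrite reprK.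
have /permP-> : perm_eq (rot k (val w)) (val w) by rewrite perm_rot.
by rewrite /= addn0.
Qed.

Lemma homogeneous_split_word alpha s :
  homogeneous (fun i => count_mem i [seq k.1 | k <- s]) (split_word (F := F) alpha s).
Proof.
elim: s => [|[i b] s IHs]; first by rewrite /split_word big_nil; apply: homogeneous1.
rewrite /split_word big_cons; apply: homogeneousM => //.
case: b; first exact: homogeneous_tvar.
rewrite /split_letter /conjugate /= addrC -scaleN1r.
apply: homogeneousP; first exact: homogeneous_tvar.
rewrite -[_ *: _]addr0; apply: homogeneousP (@homogeneous0 _).
exact: homogeneous_Trace_tvar.
Qed.

End Homogeneous.

(** * Multilinear elements and the codimension *)

Section MultilinearWords.
Variable n : nat.
Implicit Types S : n.-tuple bool.

(** The product z_1 ... z_n in which z_i is x_i if bit i of S is true, and y_i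
    otherwise. *)
Definition choice_word S : seq (nat * bool) := [seq (i, nth false S i) | i <- iota 0 n].

Definition choice_monomial S : {cmonom (nat * bool)%type} := cmonom_of_seq (choice_word S).

Lemma choice_monomialE S i b :
  choice_monomial S (i, b) = ((i < n)%N && (nth false S i == b)) :> nat.
Proof.
rewrite cmonom_of_seqE count_map.
rewrite (eq_count (a2 := fun j => (j == i) && (nth false S i == b))); last first.
  by move=> j; rewrite /= xpair_eqE; case: eqVneq => // ->.
case: (nth false S i == b); last first.
  by rewrite andbF (eq_count (a2 := pred0)) ?count_pred0 // => j; rewrite andbF.
rewrite andbT (eq_count (a2 := pred1 i)) => [|j]; last by rewrite andbT.
by rewrite count_uniq_mem ?iota_uniq // mem_iota.
Qed.

Lemma choice_monomial_inj : injective choice_monomial.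
Proof.
move=> S S' SS'; apply: eq_from_tnth => i; rewrite !(tnth_nth false).
have := choice_monomialE S i (nth false S i).
by rewrite SS' choice_monomialE ltn_ord eqxx; case: eqVneq.
Qed.

(** The exponents of x_i and y_i add up to 1 for i < n, and to 0 otherwise. *)
Lemma split_degree_choice m : split_degree (fun i => (i < n)%N : nat) m ->
  exists S, m = choice_monomial S.
Proof.
move=> md; exists [tuple m (i : nat, true) != 0%N | i < n]; apply/eqP/cmP => -[i b].
rewrite choice_monomialE; have := md i; case: ltnP => [lt_in|_].
  have -> : nth false [tuple m (i : nat, true) != 0%N | i < n] i = (m (i, true) != 0%N).
    by rewrite -(tnth_nth false _ (Ordinal lt_in)) tnth_mktuple.
  by case: b; case: (m (i, true)) => [|[|?]] //=; case: (m (i, false)) => [|[|?]].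
by move/eqP; rewrite addn_eq0; case: b => /andP[/eqP ? /eqP ?].
Qed.

Lemma coef_choice_sum (F : fieldType) (c : n.-tuple bool -> F) m :
  (\sum_S c S *: << choice_monomial S >> : spoly F)@_m =
  \sum_S c S * (choice_monomial S == m)%:R.
Proof. by rewrite raddf_sum; apply: eq_bigr => S _; rewrite /= mcoeffZ mcoeffU1. Qed.

Lemma choice_expansion (F : fieldType) (p : spoly F) :
  (forall m, m \in msupp p -> split_degree (fun i => (i < n)%N : nat) m) ->
  p = \sum_S p@_(choice_monomial S) *: << choice_monomial S >>.
Proof.
move=> pd; apply/malgP => m; rewrite coef_choice_sum.
case: (boolP (m \in msupp p)) => [mp|/mcoeff_outdom pm].
  have [S ->] := split_degree_choice (pd m mp).
  rewrite (bigD1 S) //= eqxx mulr1 big1 ?addr0 // => S' S'S.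
  by rewrite (inj_eq choice_monomial_inj) (negPf S'S) mulr0.
rewrite pm big1 // => S _.
by case: eqVneq => [->|_]; rewrite ?mulr0 // pm mul0r.
Qed.

End MultilinearWords.

(** A basis modulo W may be indexed by any finite type, here by the 2^n choices of
    bits. *)
Lemma quotient_dim_finType (F : fieldType) (V : lmodType F) (U W : V -> Prop)
    (I : finType) (b : I -> V) :
  (forall i, U (b i)) ->
  (forall v, U v -> exists! c : {ffun I -> F}, W (v - \sum_i c i *: b i)) ->
  quotient_dim U W #|I|.
Proof.
move=> Ub bP; exists (fun j => b (enum_val j)) => // v /bP[c [Wc c_uniq]].
exists (\row_j c (enum_val j)); split => [|r Wr].
  move: Wc; rewrite (big_enum_val (A := I)) /=; congr (W (_ - _)).
  by apply: eq_bigr => j _; rewrite mxE.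
have cr : c = [ffun i => r 0 (enum_rank i)].
  apply: c_uniq; move: Wr; rewrite (big_enum_val (A := I)) /=; congr (W (_ - _)).
  by apply: eq_bigr => j _; rewrite ffunE enum_valK.
by apply/rowP => j; rewrite mxE cr ffunE enum_valK.
Qed.

Theorem theorem9 (F : fieldType) (charF0 : [pchar F] =i pred0)
    (alpha : F) (alpha_neq0 : alpha != 0) :
  let x1 := tvar F 0%N in
  let x2 := tvar F 1%N in
  let f1 := x1 * x2 - x2 * x1 in
  let f3 := alpha ^+ 2 *: (x1 * x2) + alpha ^+ 2 *: (x2 * x1)
            + Trace x1 * Trace x2 - alpha *: (Trace x1 * x2)
            - alpha *: (Trace x2 * x1) - alpha *: Trace (x1 * x2) in
  (forall f : free_trace_algebra F,
      trace_identity (D2_trace alpha) f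
      <-> generated_Tideal (fun g => g = f1 \/ g = f3) f)
  /\ (forall n : nat, (1 <= n)%N -> trace_codim (D2_trace alpha) n (2 ^ n)).
Proof.
move=> x1 x2 f1 f3; set J := generated_Tideal _.
have JT : trace_Tideal J := generated_trace_Tideal _.
have Jf1 : J f1 by move=> I _; apply; left.
have Jf3 : J f3 by move=> I _; apply; right.
have IT := trace_identity_Tideal (D2_trace alpha).
have IJ := Tideal_ideal IT; have JJ := Tideal_ideal JT.
have J_identity f : J f -> trace_identity (D2_trace alpha) f.
  by apply=> // g [->|->]; [apply: D2_commutator|apply: D2_conjugation_relation].
clearbody J.
split=> [f|n _].
  split=> [If|]; last exact: J_identity.
  have [p _ fp] := reducible_any alpha_neq0 JT Jf1 Jf3 f.
  have p0 : p = 0.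
    apply: (split_poly_identity alpha_neq0 charF0).
    have := idealB IJ If (J_identity _ fp).
    by congr (trace_identity _ _); exact: subKr.
  by move: fp; rewrite p0 (linear_at0 (split_polyP alpha)) subr0.
have choices : #|{: n.-tuple bool}| = (2 ^ n)%N by rewrite card_tuple card_bool.
rewrite -choices.
pose b (S : n.-tuple bool) := split_word (F := F) alpha (choice_word S).
pose lift (c : n.-tuple bool -> F) : spoly F := \sum_S c S *: << choice_monomial S >>.
have b_lift c : J (\sum_S c S *: b S - split_poly alpha (lift c)).
  apply: (congr_lincomb _ JJ (split_polyP alpha)) => S.
  apply: (congr_eqr (split_polyU alpha _)).
  apply: (perm_split_word alpha JT Jf1).
  by rewrite perm_sym; apply: letters_of_seq.
have MTb S : homogeneous (fun i => (i < n)%N : nat) (b S).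
  apply: (homogeneous_eq _ (@homogeneous_split_word F alpha (choice_word S))) => i.
  rewrite -map_comp (eq_map (g := id)) // map_id count_uniq_mem ?iota_uniq //.
  by rewrite mem_iota.
apply: (@quotient_dim_finType _ _ _ _ _ b) => // f Mf.
have [p pd fp] := reducible_homogeneous alpha_neq0 JT Jf1 Jf3 Mf.
pose c := [ffun S : n.-tuple bool => p@_(choice_monomial S)].
have lift_c : lift c = p.
  rewrite [RHS](choice_expansion pd); by apply: eq_bigr => S _; rewrite ffunE.
exists c; split => [|c' [_ fc']].
  split.
    rewrite addrC -scaleN1r; apply: homogeneousP Mf.
    exact: homogeneous_lincomb.
  apply: J_identity; have := congr_sym JJ (b_lift c); rewrite lift_c.
  exact: (congr_trans JJ fp).
(* The two expansions p and lift c' of f evaluate alike, so they are equal. *)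
have fsc' := congr_trans IJ fc' (J_identity _ (b_lift c')).
have pc' := congr_trans IJ (congr_sym IJ (J_identity _ fp)) fsc'.
have pc'0 : -1 *: lift c' + p = 0.
  apply: (split_poly_identity alpha_neq0 charF0).
  move: pc'; rewrite addrC -scaleN1r => H phi; rewrite split_polyP; exact: H.
have def_p : p = lift c' by apply/subr0_eq; rewrite addrC -scaleN1r.
apply/ffunP => S; rewrite ffunE def_p coef_choice_sum (bigD1 S) //= eqxx mulr1.
rewrite big1 ?addr0 // => S' S'S.
by rewrite (inj_eq (@choice_monomial_inj n)) (negPf S'S) mulr0.
Qed.
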